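(* Let $(R,\mathfrak{m})$ be a commutative Noetherian local ring and let $M$ be a finitely generated $R$-module such that every associated prime of $M$ is minimal in $\operatorname{Ass} M$ (i.e. $\operatorname{Ass} M=\operatorname{Min}\operatorname{Ass} M$). Then the following statements are equivalent: (i) $M$ is Cohen-Macaulay; (ii) $M/\mathfrak{a}M$ is an unmixed module for every ideal $\mathfrak{a}$ of $R$ which is linked with respect to $M$. In particular, if every associated prime of $R$ is a minimal prime of $R$ ($\operatorname{Ass} R=\operatorname{Min} R$), then $R$ is Cohen-Macaulay if and only if every linked ideal $\mathfrak{a}$ of $R$ is unmixed.
   Context: Regular sequences: an $M$-regular sequence $x_1,\dots,x_n$ satisfies $(x_1,\dots,x_n)M\neq M$ and may be empty (then $I=0$). Linkage: let $\mathfrak{a},\mathfrak{b}$ be non-zero proper ideals of $R$ with $\mathfrak{a}M\neq M$, $\mathfrak{b}M\neq M$, and let $I\subseteq\mathfrak{a}\cap\mathfrak{b}$ be an ideal generated by an $M$-regular sequence. Then $\mathfrak{a}$ and $\mathfrak{b}$ are linked by $I$ with respect to $M$ if $\mathfrak{b}M=IM:_M\mathfrak{a}$ and $\mathfrak{a}M=IM:_M\mathfrak{b}$, where $IM:_M\mathfrak{a}=\{m\in M:\mathfrak{a}m\subseteq IM\}$. An ideal $\mathfrak{a}$ is linked with respect to $M$ if it is linked to some ideal $\mathfrak{b}$ by some such $I$ with respect to $M$; a linked ideal of $R$ is one linked with respect to $M=R$. A finitely generated module $N$ over a local ring is unmixed if $\dim R/\mathfrak{p}=\dim N$ for all $\mathfrak{p}\in\operatorname{Ass}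 N$; an ideal $\mathfrak{a}$ is unmixed if the module $R/\mathfrak{a}$ is unmixed. *)

(* Defs.v *)
From HB Require Import structures.
From mathcomp Require Import all_boot all_order all_algebra.
From mathcomp Require Import boolp classical_sets constructive_ereal.

Set Implicit Arguments.
Unset Strict Implicit.
Unset Printing Implicit Defensive.

Import Order.TTheory GRing.Theory Num.Theory.
Local Open Scope ring_scope.
Local Open Scope quotient_scope.

(* The unit ideal is allowed, unlike in mathcomp's [idealr R]. *)
Notation ideal R := (submodClosed R^o).

Section Quotient.
Variables (R : comNzRingType) (M : lmodType R) (N : submodClosed M).

(* [submodClosed] does not inherit from [zmodClosed], which
   [Quotient.quot] expects. *)
Definition submod_pred : {pred M} := fun u => u \in N.

HB.instance Definition _ := GRing.isZmodClosed.Build M submod_pred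
  (GRing.submod_closedB (GRing.submodClosedP N)).

Definition quotmod : Type := Quotient.quot submod_pred.

HB.instance Definition _ := Quotient.on quotmod.
HB.instance Definition _ := GRing.Zmodule.on quotmod.

Definition quotmod_pi (u : M) : quotmod := \pi_(Quotient.quot submod_pred) u.

Lemma quotmod_piK (q : quotmod) : quotmod_pi (repr q) = q.
Proof. exact: reprK. Qed.

Lemma quotmod_eqP u v : quotmod_pi u = quotmod_pi v <-> u - v \in N.
Proof.
rewrite -[_ \in N]/(_ \in submod_pred) Quotient.idealrBE.
by split => [e|/eqP//]; apply/eqP.
Qed.

Lemma quotmod_piD u v : quotmod_pi (u + v) = quotmod_pi u + quotmod_pi v.
Proof. exact: (raddfD \pi_(Quotient.quot submod_pred)). Qed.

Definition quotmod_scale (r : R) (q : quotmod) : quotmod :=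
  quotmod_pi (r *: repr q).

Lemma quotmod_pi_scale r u :
  quotmod_scale r (quotmod_pi u) = quotmod_pi (r *: u).
Proof.
apply/quotmod_eqP; rewrite -scalerBr; apply: rpredZ.
by apply/quotmod_eqP; rewrite quotmod_piK.
Qed.

Lemma quotmod_scaleA a b q :
  quotmod_scale a (quotmod_scale b q) = quotmod_scale (a * b) q.
Proof. by rewrite -(quotmod_piK q) !quotmod_pi_scale scalerA. Qed.

Lemma quotmod_scale1 : left_id 1 quotmod_scale.
Proof. by move=> q; rewrite -(quotmod_piK q) quotmod_pi_scale scale1r. Qed.

Lemma quotmod_scaleDr : right_distributive quotmod_scale +%R.
Proof.
move=> a q q'; rewrite -(quotmod_piK q) -(quotmod_piK q').
by rewrite -quotmod_piD !quotmod_pi_scale scalerDr quotmod_piD.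
Qed.

Lemma quotmod_scaleDl q : {morph quotmod_scale^~ q : a b / a + b}.
Proof.
move=> a b /=; rewrite -(quotmod_piK q) !quotmod_pi_scale.
by rewrite scalerDl quotmod_piD.
Qed.

HB.instance Definition _ := GRing.Zmodule_isLmodule.Build R quotmod
  quotmod_scaleA quotmod_scale1 quotmod_scaleDr quotmod_scaleDl.

Lemma quotmod_pi_is_linear : linear quotmod_pi.
Proof. by move=> a u v; rewrite quotmod_piD -quotmod_pi_scale. Qed.

HB.instance Definition _ :=
  GRing.isLinear.Build R M quotmod _ quotmod_pi quotmod_pi_is_linear.

End Quotient.

Section Submodules.
Variables (R : comNzRingType) (M : lmodType R).

Definition submod_gen (s : seq M) : {pred M} :=
  fun x => `[< exists c : 'I_(size s) -> R, x = \sum_i c i *: s`_i >].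

Lemma submod_gen_closed s : submod_closed (submod_gen s).
Proof.
split=> [|a u v /asboolP[c ->] /asboolP[d ->]]; apply/asboolP.
  by exists (fun=> 0); rewrite big1 // => i _; rewrite scale0r.
exists (fun i => a * c i + d i); rewrite scaler_sumr -big_split /=.
by apply: eq_bigr => i _; rewrite scalerDl scalerA.
Qed.

HB.instance Definition _ s :=
  GRing.isSubmodClosed.Build R M (submod_gen s) (submod_gen_closed s).

Definition fin_gen (N : {pred M}) : Prop := exists s : seq M, N =i submod_gen s.

Definition ideal_mul (a : {pred R}) : {pred M} :=
  fun x => `[< exists n (r : 'I_n -> R) (u : 'I_n -> M),
                 (forall i, r i \in a) /\ x = \sum_i r i *: u i >].

Lemma ideal_mul_submod_closed a : submod_closed (ideal_mul a).
Proof.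
split=> [|c _ _ /asboolP[n [r [u [ra ->]]]] /asboolP[k [s [v [sa ->]]]]].
  apply/asboolP; exists 0%N, (fun=> 0), (fun=> 0).
  by split=> [[]//|]; rewrite big_ord0.
apply/asboolP; exists (n + k)%N.
exists (fun i => match split i with inl j => r j | inr j => s j end).
exists (fun i => match split i with inl j => c *: u j | inr j => v j end).
split=> [i|]; first by case: (split i).
rewrite big_split_ord /= scaler_sumr; congr (_ + _); apply: eq_bigr => i _.
  by rewrite (unsplitK (inl i)) !scalerA mulrC.
by rewrite (unsplitK (inr i)).
Qed.

HB.instance Definition _ a :=
  GRing.isSubmodClosed.Build R M (ideal_mul a) (ideal_mul_submod_closed a).

Definition colon (N : {pred M}) (a : {pred R}) : {pred M} :=
  fun u => `[< forall r, r \in a -> r *: u \in N >].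

Definition zero_module : Prop := forall u : M, u = 0.

End Submodules.

Arguments ideal_mul {R} M a.

Section Rings.
Variable R : comNzRingType.

Definition is_proper (a : ideal R) : Prop := 1 \notin a.

Definition nonzero_ideal (a : ideal R) : Prop := exists2 r : R, r \in a & r != 0.

Definition prime_ideal (p : ideal R) : Prop :=
  is_proper p /\ forall r s : R, r * s \in p -> (r \in p) || (s \in p).

Definition maximal_ideal (m : ideal R) : Prop :=
  is_proper m /\
  forall a : ideal R, is_proper a -> {subset m <= a} -> {subset a <= m}.

Definition noetherian : Prop := forall a : ideal R, fin_gen a.

Definition local_ring (m : ideal R) : Prop :=
  maximal_ideal m /\ forall n : ideal R, maximal_ideal n -> n =i m.

Definition minimal_prime (p : ideal R) : Prop :=
  prime_ideal p /\
  forall q : ideal R, prime_ideal q -> {subset q <= p} -> {subset p <= q}.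

End Rings.

Section Modules.
Variable R : comNzRingType.
Implicit Type M : lmodType R.

Definition Ass M (p : ideal R) : Prop :=
  prime_ideal p /\ exists u : M, forall r : R, r \in p <-> r *: u = 0.

Definition minimal_Ass M (p : ideal R) : Prop :=
  Ass M p /\ forall q : ideal R, Ass M q -> {subset q <= p} -> {subset p <= q}.

Definition annihilates M (r : R) : Prop := forall u : M, r *: u = 0.

(* Chains p_0 < ... < p_n of primes of R/Ann(M), seen as primes of R that
   contain Ann(M). *)
Definition prime_chain M (n : nat) (p : 'I_n.+1 -> ideal R) : Prop :=
  [/\ forall i, prime_ideal (p i),
      forall i r, annihilates M r -> r \in p i
    & forall i j : 'I_n.+1, (i < j)%N ->
        {subset p i <= p j} /\ ~ {subset p j <= p i}].

(* The dimension of M is dim R/Ann(M), with the value -oo for the zero module. *)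
Definition krull_dim M : \bar int :=
  supremum -oo%E
    [set (n%:Z)%:E%E | n in [set n | exists p : 'I_n.+1 -> ideal R,
                                       prime_chain M p]]%classic.

Definition nonzerodivisor M (r : R) : Prop :=
  forall u : M, r *: u = 0 -> u = 0.

Definition regular_seq M (xs : seq R) : Prop :=
  (forall i, (i < size xs)%N ->
     nonzerodivisor
       (quotmod (ideal_mul M (submod_gen (take i xs : seq R^o)))) xs`_i) /\
  ~ (forall u : M, u \in ideal_mul M (submod_gen (xs : seq R^o))).

Definition depth (m : ideal R) M : \bar int :=
  supremum -oo%E
    [set ((size xs)%:Z)%:E%E | xs in [set xs : seq R |
        regular_seq M xs /\ {subset xs <= m}]]%classic.

(* The zero module counts as Cohen-Macaulay. *)
Definition cohen_macaulay (m : ideal R) M : Prop :=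
  zero_module M \/ depth m M = krull_dim M.

Definition unmixed M : Prop :=
  forall p : ideal R, Ass M p -> krull_dim (quotmod p) = krull_dim M.

Definition linked_by M (I a b : ideal R) : Prop :=
  [/\ nonzero_ideal a /\ nonzero_ideal b,
      is_proper a /\ is_proper b,
      ~ (forall u : M, u \in ideal_mul M a) /\
      ~ (forall u : M, u \in ideal_mul M b),
      [/\ exists2 xs : seq R, regular_seq M xs & I =i submod_gen (xs : seq R^o),
          {subset I <= a} & {subset I <= b}]
    & ideal_mul M b =i colon (ideal_mul M I) a /\
      ideal_mul M a =i colon (ideal_mul M I) b].

Definition linked M (a : ideal R) : Prop :=
  exists I b : ideal R, linked_by M I a b.

Definition unmixed_ideal (a : ideal R) : Prop := unmixed (quotmod a).

End Modules.

(* Main.v *)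
From HB Require Import structures.
From Stdlib Require List.
Require Import Defs.
From mathcomp Require Import all_boot all_order all_algebra.
From mathcomp Require Import zify ring.
From mathcomp Require Import boolp classical_sets constructive_ereal.

(* (i) => (ii): if [a] is linked to [b] by [I], then [aM = IM : b] shows that
   [Ass (M/aM)] is contained in [Ass (M/IM)].  From an associated prime of a
   module with a regular sequence of length [n] starts a chain of primes of
   length [n], and [M/IM] has depth at least [depth M] minus the length of the
   sequence generating [I]; hence each of these primes has the maximal dimension.

   (ii) => (i): a nonempty regular sequence [x1, ..., xn] generates an ideal
   which is linked to itself by [(x1, ..., xn^2)], so [M/(x1, ..., xn)M] is
   always unmixed.  Given a chain of primes of length [k + 1] in the support of
   an unmixed [N], move it to one starting above a maximal associated prime [p]
   of [N]; the first prime strictly above [p] lies in no associated prime, so it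
   contains an [N]-regular element [x] by prime avoidance, and the rest of the
   chain lies in the support of [N/xN].  By induction, chains of length [k] give
   regular sequences of length [k].  No dimension theory (not even finiteness
   of the dimension) is needed. *)

Set Implicit Arguments.
Unset Strict Implicit.
Unset Printing Implicit Defensive.

Import Order.TTheory GRing.Theory Num.Theory.
Local Open Scope ring_scope.

(** * Submodules and Noetherian induction *)

Section Packing.
Variables (R : comNzRingType) (M : lmodType R).

Definition subspace_prop (P : M -> Prop) : Prop :=
  P 0 /\ forall (a : R) u v, P u -> P v -> P (a *: u + v).

Definition pred_of_prop P (_ : subspace_prop P) : {pred M} := fun u => `[< P u >].

Lemma pred_of_prop_closed P (h : subspace_prop P) :
  submod_closed (pred_of_prop h).
Proof.
case: (h) => P0 PD; split=> [|a u v /asboolP Pu /asboolP Pv]; apply/asboolP => //.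
exact: PD.
Qed.

HB.instance Definition _ P (h : subspace_prop P) :=
  GRing.isSubmodClosed.Build R M (pred_of_prop h) (pred_of_prop_closed h).

Lemma submod_of_subproof P (h : subspace_prop P) :
  {N : submodClosed M | forall u, u \in N <-> P u}.
Proof.
by exists (pred_of_prop h : submodClosed M) => u; split=> [/asboolP|?] //; apply/asboolP.
Qed.

Definition submod_of P (h : subspace_prop P) : submodClosed M :=
  sval (submod_of_subproof h).

Lemma submod_ofP P (h : subspace_prop P) u : u \in submod_of h <-> P u.
Proof. exact: (svalP (submod_of_subproof h) u). Qed.

(** Functional extensionality identifies the carriers and proof irrelevance the closure proofs, so
    submodules can be rewritten as equals. *)
Lemma submodP (N N' : submodClosed M) : N =i N' -> N = N'.
Proof.
case: N N' => [A cA] [B cB] /= eAB.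
have {}eAB : A = B by apply/funext => u; exact: eAB.
case: _ / eAB in cB *; congr GRing.SubmodClosed.Pack.
case: cA cB => [[a1] [a2]] [[b1] [b2]].
by rewrite (Prop_irrelevance a1 b1) (Prop_irrelevance a2 b2).
Qed.

Lemma submod_eq (N N' : submodClosed M) :
  {subset N <= N'} -> {subset N' <= N} -> N = N'.
Proof. by move=> h h'; apply: submodP => u; apply/idP/idP; [exact: h|exact: h']. Qed.

(* [rpredB] does not apply, as [submodClosed] is not a [zmodClosed]. *)
Lemma submodB (N : submodClosed M) u v : u \in N -> v \in N -> u - v \in N.
Proof. by move=> uN vN; rewrite -scaleN1r; apply: rpredD => //; exact: rpredZ. Qed.

Lemma mem_submod_gen_nil u : (u \in submod_gen ([::] : seq M)) = (u == 0).
Proof.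
apply/asboolP/eqP => [[c ->]|->]; first by rewrite big_ord0.
by exists (fun=> 0); rewrite big_ord0.
Qed.

Lemma mem_submod_gen_cons x s u :
  u \in submod_gen (x :: s : seq M) <-> exists r : R, u - r *: x \in submod_gen s.
Proof.
split=> [/asboolP[c ->]|[r /asboolP[c e]]].
  exists (c ord0); rewrite big_ord_recl /= addrC addKr.
  by apply/asboolP; exists (fun i => c (lift ord0 i)).
apply/asboolP; exists (fun i => oapp c r (unlift ord0 i)).
rewrite big_ord_recl /= unlift_none /= -[LHS](subrK (r *: x)) addrC e.
by congr (_ + _); apply: eq_bigr => i _; rewrite liftK.
Qed.

Lemma mem_submod_gen (s : seq M) x : x \in s -> x \in submod_gen s.
Proof.
elim: s => // y s IHs; rewrite inE => /predU1P[->|/IHs xs];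
  apply/mem_submod_gen_cons.
  by exists 1; rewrite scale1r subrr rpred0.
by exists 0; rewrite scale0r subr0.
Qed.

Lemma submod_gen_sub (s : seq M) (N : submodClosed M) :
  {subset s <= N} -> {subset submod_gen s <= N}.
Proof.
elim: s => [|x s IHs] sN u.
  by rewrite mem_submod_gen_nil => /eqP->; rewrite rpred0.
move=> /mem_submod_gen_cons[r us]; rewrite -(subrK (r *: x) u).
have xN : x \in N by apply: sN; exact: mem_head.
apply: rpredD; last exact: rpredZ.
by apply: IHs us => v vs; apply: sN; rewrite inE vs orbT.
Qed.

Definition max_cond (F : submodClosed M -> Prop) : Prop :=
  (exists N, F N) ->
  exists2 N, F N & forall N', F N' -> {subset N <= N'} -> N' = N.

End Packing.

Section Ideals.
Variable R : comNzRingType.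
Implicit Types (a p : ideal R).

Lemma mem_idealMl a (r s : R) : s \in a -> r * s \in a.
Proof. exact: (@rpredZ _ _ a r s). Qed.

Lemma mem_idealMr a (r s : R) : r \in a -> r * s \in a.
Proof. by rewrite mulrC; exact: mem_idealMl. Qed.

Lemma mem_ideal0 a : (0 : R) \in a. Proof. exact: (@rpred0 _ a). Qed.

Lemma mem_idealD a (r s : R) : r \in a -> s \in a -> r + s \in a.
Proof. exact: (@rpredD _ a). Qed.

Lemma mem_idealB a (r s : R) : r \in a -> s \in a -> r - s \in a.
Proof. exact: (@submodB _ R^o a). Qed.

(* Restates [submod_ofP] for members typed in [R] rather than [R^o]. *)
Lemma ideal_ofP (P : R -> Prop) (h : subspace_prop (M := R^o) P) (r : R) :
  r \in submod_of h <-> P r.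
Proof. exact: (@submod_ofP R R^o P h r). Qed.

Lemma prime_idealM p (r s : R) :
  prime_ideal p -> r \notin p -> s \notin p -> r * s \notin p.
Proof. by case=> _ pp rp sp; apply/negP => /pp; rewrite (negPf rp) (negPf sp). Qed.

(** Without a maximal member, choice yields a strictly ascending sequence in [F]; its union is
    finitely generated, hence contained in one of its terms. *)
Lemma noetherian_max_cond (F : ideal R -> Prop) : noetherian R -> max_cond F.
Proof.
move=> noeth [a0 Fa0]; apply: contrapT => nomax.
have next (a : {a | F a}) : exists b : {b | F b},
    {subset sval a <= sval b} /\ ~ {subset sval b <= sval a}.
  case: a => a Fa /=; apply: contrapT => h; apply: nomax; exists a => // b Fb ab.
  apply: submod_eq => //; apply: contrapT => ba.
  by apply: h; exists (exist _ b Fb).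
have [f fP] := choice next.
pose A n := sval (iter n f (exist _ a0 Fa0)).
have A1 n : {subset A n <= A n.+1} by have [] := fP (iter n f (exist _ a0 Fa0)).
have A2 n : ~ {subset A n.+1 <= A n} by have [] := fP (iter n f (exist _ a0 Fa0)).
have Amono n k : (n <= k)%N -> {subset A n <= A k}.
  elim: k => [|k IHk]; first by rewrite leqn0 => /eqP->.
  by rewrite leq_eqVlt ltnS => /predU1P[->//|/IHk nk u /nk]; exact: A1.
pose U (r : R^o) := exists n, r \in A n.
have Usub : subspace_prop U.
  split=> [|c u v [i ui] [j vj]]; first by exists 0%N; exact: mem_ideal0.
  exists (maxn i j); apply: mem_idealD; last exact: (Amono _ _ (leq_maxr _ _)).
  by apply: mem_idealMl; exact: (Amono _ _ (leq_maxl _ _)).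
have [s sU] := noeth (submod_of Usub).
have [n sn] : exists n, {subset s <= A n}.
  have : {subset s <= submod_of Usub} by move=> u /mem_submod_gen; rewrite sU.
  elim: {sU} s => [|x s IHs] sU; first by exists 0%N.
  have [n sn] := IHs (fun u us => sU u (mem_behead (s := x :: s) us)).
  have /submod_ofP[k xk] := sU x (mem_head _ _).
  exists (maxn n k) => u; rewrite inE => /predU1P[->|/sn].
    exact: (Amono _ _ (leq_maxr _ _)).
  exact: (Amono _ _ (leq_maxl _ _)).
apply: (@A2 n) => u un; apply: (submod_gen_sub sn).
by rewrite -sU; apply/submod_ofP; exists n.+1.
Qed.

End Ideals.

Section NoetherianModule.
Variables (R : comNzRingType) (M : lmodType R).
Hypothesis R_noetherian : noetherian R.

(** The leading ideal: the coefficients of [x] in the members of [N] that lie in the span of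
    [x :: s]. *)
Lemma lead_subspace (N : submodClosed M) (x : M) s :
  subspace_prop (M := R^o)
    (fun r => exists2 v, v \in submod_gen s & r *: x + v \in N).
Proof.
split=> [|a r t [u us uN] [v vs vN]].
  by exists 0; rewrite ?rpred0 // scale0r addr0 rpred0.
exists (a *: u + v); first by rewrite rpredD // rpredZ.
by rewrite scalerDl -scalerA addrACA -scalerDr rpredD // rpredZ.
Qed.

Lemma cap_subspace (N N' : submodClosed M) :
  subspace_prop (fun u : M => u \in N /\ u \in N').
Proof.
split=> [|a u v [? ?] [? ?]]; first by rewrite !rpred0.
by rewrite !rpredD // rpredZ.
Qed.

(** Induction on the number of generators: maximise first the leading ideal, then the intersection
    with the span of [s]. Nested submodules that agree in both are equal. *)
Lemma fin_gen_max_cond s (F : submodClosed M -> Prop) :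
  (forall N, F N -> {subset N <= submod_gen s}) -> max_cond F.
Proof.
elim: s F => [|x s IHs] F Fs [N FN].
  exists N => // N' FN' NN'; apply: submod_eq => // u /(Fs _ FN').
  by rewrite mem_submod_gen_nil => /eqP->; rewrite rpred0.
pose lead N := submod_of (lead_subspace N x s).
pose cap N := submod_of (cap_subspace N (submod_gen s)).
have [] := @noetherian_max_cond R (fun a => exists2 N, F N & a = lead N) R_noetherian.
  by exists (lead N), N.
move=> _ [{FN}N FN ->] leadmax.
have [] := IHs (fun C => exists N', [/\ F N', lead N' = lead N & C = cap N']).
- by move=> _ [N' [_ _ ->]] u /submod_ofP[].
- by exists (cap N), N.
move=> _ [N1 [FN1 e1 ->]] capmax; exists N1 => // N2 FN2 N12.
have e2 : lead N2 = lead N1.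
  rewrite e1; apply: leadmax; first by exists N2.
  rewrite -e1 => r /submod_ofP[v vs vN]; apply/submod_ofP; exists v => //.
  exact: N12.
have ec : cap N2 = cap N1.
  apply: capmax; first by exists N2; split=> //; rewrite e2.
  by move=> u /submod_ofP[uN us]; apply/submod_ofP; split=> //; exact: N12.
apply: submod_eq => // u uN2.
have /mem_submod_gen_cons[r vs] := Fs _ FN2 _ uN2.
have : r \in lead N2 by apply/ideal_ofP; exists (u - r *: x); rewrite // addrC subrK.
rewrite e2 => /ideal_ofP[w ws wN].
have : u - (r *: x + w) \in cap N2.
  apply/submod_ofP; split; first by apply: submodB; [|exact: N12].
  by rewrite opprD addrA; exact: submodB.
by rewrite ec => /submod_ofP[h _]; rewrite -(subrK (r *: x + w) u) rpredD.
Qed.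

End NoetherianModule.

(** * Associated primes, regular sequences and chains *)

Section Core.
Variables (R : comNzRingType) (m : ideal R) (M : lmodType R).
Hypotheses (R_noetherian : noetherian R) (R_local : local_ring m).
Hypothesis M_fin_gen : fin_gen (predT : {pred M}).
Implicit Types (N : submodClosed M) (p q P : ideal R) (r s t x y z : R) (u v w : M).

Lemma submod_max_cond (F : submodClosed M -> Prop) : max_cond F.
Proof.
have [s Ms] := M_fin_gen; apply: (@fin_gen_max_cond R M R_noetherian s) => N _ u _.
by rewrite -Ms.
Qed.

(** The multiples of a non-unit form a proper ideal, and a maximal ideal above it must be [m]. *)
Lemma local_unit r : r \notin m -> exists s, s * r = 1.
Proof.
have [_ loc] := R_local; move=> /negP rm; apply: contrapT => nunit; apply: rm.
have rsub : subspace_prop (M := R^o) (fun t => exists s : R, t = s * r).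
  split=> [|a _ _ [s ->] [t ->]]; first by exists 0; rewrite mul0r.
  by exists (a * s + t); rewrite mulrDl -mulrA.
pose F (a : ideal R) := is_proper a /\ {subset submod_of rsub <= a}.
have [] := noetherian_max_cond (F := F) R_noetherian.
  exists (submod_of rsub); split=> //; apply/negP => /ideal_ofP[s e].
  by apply: nunit; exists s.
move=> n [n1 rn] nmax.
have nM : maximal_ideal n.
  split=> // a a1 na; rewrite (nmax a) //; split=> // t /rn; exact: na.
rewrite -(loc n nM); apply: rn; apply/ideal_ofP; exists 1; by rewrite mul1r.
Qed.

Lemma local_prime : prime_ideal m.
Proof.
have [[m1 _] _] := R_local; split=> // r s rs.
have [//|/local_unit[t tr]] := boolP (r \in m).
by rewrite -[s]mul1r -tr -mulrA mem_idealMl ?orbT.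
Qed.

Lemma proper_sub_local (a : ideal R) : is_proper a -> {subset a <= m}.
Proof.
move=> a1 r ra; apply: contraT => /local_unit[s sr]; case/negP: a1.
by rewrite -sr; exact: mem_idealMl.
Qed.

(* The suffix [q] marks notions for the quotient [M/N], expressed in [M], so
   that all quotients by initial segments of a sequence live in one module. *)
Lemma annq_subspace N : subspace_prop (M := R^o) (fun r => forall u, (r : R) *: u \in N).
Proof.
split=> [u|a r t rN tN u]; first by rewrite scale0r rpred0.
by rewrite scalerDl -[a *: r]/(a * r) -scalerA rpredD // rpredZ.
Qed.

Definition annq N : ideal R := submod_of (annq_subspace N).

Lemma colon1_subspace N u : subspace_prop (M := R^o) (fun r => (r : R) *: u \in N).
Proof.
split=> [|a r t rN tN]; first by rewrite scale0r rpred0.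
by rewrite scalerDl -[a *: r]/(a * r) -scalerA rpredD // rpredZ.
Qed.

Definition colon1 N u : ideal R := submod_of (colon1_subspace N u).

Lemma submod_scale_mul N (a b c : R) u : b *: u \in N -> c = a * b -> c *: u \in N.
Proof. by move=> bu ->; rewrite -scalerA rpredZ. Qed.

Lemma submod_scale_trans N (a b c d e f : R) u v w :
  b *: u - c *: v \in N -> e *: v - f *: w \in N -> a * c = d * e ->
  (a * b) *: u - (d * f) *: w \in N.
Proof.
move=> uv vw ac.
have -> : (a * b) *: u - (d * f) *: w
    = a *: (b *: u - c *: v) + d *: (e *: v - f *: w).
  by rewrite !scalerBr !scalerA ac addrA subrK.
by rewrite rpredD // rpredZ.
Qed.

(** * Localisation at a prime and Nakayama's lemma *)

Section Saturation.
Variables (P : ideal R) (P_prime : prime_ideal P) (N : submodClosed M).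

Lemma prime_notin1 : 1 \notin P. Proof. by case: P_prime. Qed.

(** The preimage in [M] of the cyclic submodule generated by [v] in the localisation of [M/N] at
    [P]. *)
Lemma sat_subspace v : subspace_prop
  (fun w => exists t c, t \notin P /\ t *: w - c *: v \in N).
Proof.
split=> [|a w1 w2 [t1 [c1 [t1P h1]]] [t2 [c2 [t2P h2]]]].
  by exists 1, 0; rewrite prime_notin1 scaler0 scale0r subr0 rpred0.
exists (t1 * t2), (a * t2 * c1 + t1 * c2); split; first exact: prime_idealM.
have -> : (t1 * t2) *: (a *: w1 + w2) - (a * t2 * c1 + t1 * c2) *: v
    = (a * t2) *: (t1 *: w1 - c1 *: v) + t1 *: (t2 *: w2 - c2 *: v).
  rewrite !scalerBr scalerDr scalerDl !scalerA opprD addrACA.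
  by congr (_ *: _ - _ + _); ring.
by rewrite rpredD // rpredZ.
Qed.

(* Nakayama's lemma for the localisation of [M/N] at [P]: the saturations of
   the cyclic submodules generated by the members of [S] have a maximal one. *)
Lemma local_nakayama (S : M -> Prop) :
  (forall u, S u -> exists r x v,
     [/\ r \notin P, x \in P, S v & r *: u - x *: v \in N]) ->
  forall u, S u -> exists2 t, t \notin P & t *: u \in N.
Proof.
move=> Sdiv u0 Su0; apply: contrapT => u0bad.
pose bad u := S u /\ ~ exists2 t, t \notin P & t *: u \in N.
have [] := submod_max_cond
  (F := fun K => exists2 v, bad v & K = submod_of (sat_subspace v)).
  by exists (submod_of (sat_subspace u0)), u0.
move=> _ [v [Sv vbad] ->] vmax.
have [r [x [v' [rP xP Sv' e]]]] := Sdiv _ Sv.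
have v'bad : bad v'.
  split=> // -[t tP tv']; apply: vbad; exists (t * r); first exact: prime_idealM.
  rewrite -(subrK ((t * x) *: v') (_ *: v)) rpredD //.
    by rewrite -!scalerA -scalerBr rpredZ.
  by rewrite mulrC -scalerA rpredZ.
(* In the localisation [v] is a multiple of [v'], so the saturation of [v'] contains that of [v]; by
   maximality they coincide. *)
have : v' \in submod_of (sat_subspace v).
  rewrite -(vmax (submod_of (sat_subspace v'))); last 2 first.
  - by exists v'.
  - move=> w /submod_ofP[t [c [tP tw]]]; apply/submod_ofP.
    exists (r * t), (c * x); split; first exact: prime_idealM.
    exact: submod_scale_trans tw e (mulrC _ _).
  apply/submod_ofP; exists 1, 1; rewrite subrr rpred0; split=> //.
  exact: prime_notin1.
move=> /submod_ofP[t [c [tP tv']]]; case: v'bad => _; apply.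
(* From [t v' = c v] and [r v = x v'] modulo [N], this element kills [v']; it avoids [P] since [x]
   is in [P] and [r t] is not. *)
exists (r * t - c * x).
  apply: contra (prime_idealM P_prime rP tP) => h.
  by rewrite -(subrK (c * x) (r * t)) mem_idealD // mem_idealMl.
rewrite scalerBl; exact: submod_scale_trans tv' e (mulrC _ _).
Qed.

End Saturation.

(** The product of one denominator per generator works for the whole span and still avoids the prime
    [P]. *)
Lemma clear_denominators (L : lmodType R) (K : submodClosed L) P (g : seq L) :
  prime_ideal P ->
  (forall l, l \in g -> exists2 t, t \notin P & t *: l \in K) ->
  exists2 t, t \notin P & forall l, l \in submod_gen g -> t *: l \in K.
Proof.
move=> Pp; elim: g => [|l g IHg] gK.
  exists 1; first by case: Pp.
  by move=> l; rewrite mem_submod_gen_nil => /eqP->; rewrite scaler0 rpred0.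
have [|t tP tg] := IHg; first by move=> k kg; apply: gK; rewrite inE kg orbT.
have [s sP sl] := gK l (mem_head _ _).
exists (s * t); first exact: prime_idealM.
move=> k /mem_submod_gen_cons[r /tg h].
rewrite -(subrK (r *: l) k) scalerDr rpredD //; first by rewrite -scalerA rpredZ.
rewrite scalerA (_ : s * t * r = (t * r) * s); last by ring.
by rewrite -scalerA rpredZ.
Qed.

(** * Existence of associated primes *)

Definition assq N p : Prop :=
  prime_ideal p /\ exists u, forall r, r \in p <-> r *: u \in N.

(** Among the annihilators of non-zero multiples of [u] in the localisation at [P], a maximal one
    [p] is prime. As [p] is finitely generated, a single [t] outside [P] makes it an exact
    annihilator in [M/N]. *)
Lemma assq_between N P u : prime_ideal P ->
  (forall t, t \notin P -> t *: u \notin N) ->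
  exists p, [/\ assq N p, forall r, r *: u \in N -> r \in p & {subset p <= P}].
Proof.
move=> Pp uN.
have P1 : 1 \notin P by case: Pp.
have satP w : subspace_prop (M := R^o)
    (fun r => exists2 t : R, t \notin P & (t * r) *: w \in N).
  split=> [|a r1 r2 [t1 t1P h1] [t2 t2P h2]].
    by exists 1 => //; rewrite mulr0 scale0r rpred0.
  exists (t1 * t2); first exact: prime_idealM.
  rewrite -[a *: r1]/(a * r1) mulrDr scalerDl rpredD //.
    by apply: (submod_scale_mul (a := t2 * a) h1); ring.
  by apply: (submod_scale_mul (a := t1) h2); ring.
pose F (a : ideal R) := exists2 c : R,
  (forall t, t \notin P -> t *: (c *: u) \notin N) & a = submod_of (satP (c *: u)).
have [] := noetherian_max_cond (F := F) R_noetherian.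
  exists (submod_of (satP (1 *: u))), 1 => // t; rewrite scale1r; exact: uN.
move=> p [c cu pE] pmax.
have pP : {subset p <= P}.
  move=> r; rewrite pE => /ideal_ofP[t tP]; apply: contraLR => rP.
  by apply: cu; exact: prime_idealM.
have pp : prime_ideal p.
  split; first by apply: contra P1; exact: pP.
  move=> a b; have [//|ap] := boolP (a \in p) => abp /=.
  have acu t : t \notin P -> t *: ((a * c) *: u) \notin N.
    move=> tP; apply: contra ap; rewrite -scalerA scalerA => h.
    by rewrite pE; apply/ideal_ofP; exists t.
  rewrite -(pmax (submod_of (satP ((a * c) *: u)))).
  - move: abp; rewrite pE => /ideal_ofP[t tP h]; apply/ideal_ofP; exists t => //.
    by move: h; rewrite !scalerA (_ : t * b * (a * c) = t * (a * b) * c) //; ring.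
  - by exists (a * c).
  move=> r; rewrite pE => /submod_ofP[t tP h]; apply/submod_ofP; exists t => //.
  by move: h; rewrite !scalerA => h; apply: (submod_scale_mul (a := a) h); ring.
have [s ps] := R_noetherian p.
have [|t tP ht] := @clear_denominators R^o (colon1 N (c *: u)) P s Pp.
  move=> r /mem_submod_gen; rewrite -ps pE => /submod_ofP[t tP h].
  by exists t => //; apply/submod_ofP.
exists p; split=> //; last first.
  move=> r ru; rewrite pE; apply/ideal_ofP; exists 1 => //.
  by rewrite mul1r scalerA mulrC -scalerA rpredZ.
split=> //; exists (t *: (c *: u)) => r; rewrite scalerA mulrC; split=> [rp|h].
  have /ht/ideal_ofP// : (r : R^o) \in submod_gen s by rewrite -ps.
by rewrite pE; apply/ideal_ofP; exists t.
Qed.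

Lemma assq_exists N u : u \notin N ->
  exists2 p, assq N p & forall r, r *: u \in N -> r \in p.
Proof.
move=> uN; have [|p [pA up _]] := assq_between (N := N) (u := u) local_prime.
  move=> t /local_unit[s st]; apply: contra uN => tu.
  by rewrite -[u]scale1r -st -scalerA rpredZ.
by exists p.
Qed.

(** Either some [u] survives in the localisation at [P], or one [t] outside [P] kills [M/N], against
    the assumption on the annihilator. *)
Lemma assq_sub_prime N P : prime_ideal P -> {subset annq N <= P} ->
  exists2 p, assq N p & {subset p <= P}.
Proof.
move=> Pp annP; have [s Ms] := M_fin_gen.
have [[u uN]|nou] := pselect (exists u, forall t, t \notin P -> t *: u \notin N).
  by have [p [pA _ pP]] := assq_between Pp uN; exists p.
have [|t tP tM] := @clear_denominators M N P s Pp.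
  move=> u us; apply: contrapT => h; apply: nou; exists u => t tP.
  by apply/negP => tu; apply: h; exists t.
case/negP: tP; apply: annP; apply/ideal_ofP => u; apply: tM; by rewrite -Ms.
Qed.

Lemma addx_subspace N x : subspace_prop (fun u => exists w, u - x *: w \in N).
Proof.
split=> [|a u v [w uw] [w' vw']]; first by exists 0; rewrite scaler0 subr0 rpred0.
exists (a *: w + w'); have -> : a *: u + v - x *: (a *: w + w')
    = a *: (u - x *: w) + (v - x *: w').
  by rewrite scalerBr scalerDr !scalerA (mulrC x) opprD addrACA.
by rewrite rpredD // rpredZ.
Qed.

(** The submodule [N + xM]; passing to it divides [M/N] by [x]. *)
Definition addx N x : submodClosed M := submod_of (addx_subspace N x).

Lemma addxP N x u : u \in addx N x <-> exists w, u - x *: w \in N.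
Proof. exact: submod_ofP. Qed.

Lemma sub_addx N x : {subset N <= addx N x}.
Proof. by move=> u uN; apply/addxP; exists 0; rewrite scaler0 subr0. Qed.

Lemma mem_addx N x w : x *: w \in addx N x.
Proof. by apply/addxP; exists w; rewrite subrr rpred0. Qed.

Lemma addx_least N N' x : {subset N <= N'} -> (forall w, x *: w \in N') ->
  {subset addx N x <= N'}.
Proof.
by move=> NN' xN' u /addxP[w /NN' h]; rewrite -(subrK (x *: w) u) rpredD.
Qed.

Lemma addxAC N x y : addx (addx N x) y = addx (addx N y) x.
Proof.
have sub a b : {subset addx (addx N a) b <= addx (addx N b) a}.
  apply: addx_least => [|w]; last by apply: sub_addx; exact: mem_addx.
  apply: addx_least => [u uN|w]; last exact: mem_addx.
  by do 2!apply: sub_addx.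
exact: submod_eq.
Qed.

(** * Non-zero-divisors and finiteness of the set of associated primes *)

Definition nzdq N x : Prop := forall u, x *: u \in N -> u \in N.

Lemma nzdq_notin_assq N p x : nzdq N x -> assq N p -> x \notin p.
Proof.
move=> xN [[p1 _] [u pu]]; apply/negP => /pu/xN uN.
by case/negP: p1; apply/pu; rewrite scale1r.
Qed.

(** Noetherian induction: adjoin to a maximal counterexample [N] an element [v] with annihilator [p]
    modulo [N]. Each associated prime of [N] is then [p] or associated to the larger submodule. *)
Lemma assq_finite N : exists L, forall p, List.In p L <-> assq N p.
Proof.
suff [L NL] : exists L, forall p, assq N p -> List.In p L.
  exists (List.filter (fun p => `[< assq N p >]) L) => p.
  rewrite List.filter_In; split=> [[_ /asboolP]//|pN].
  by split; [exact: NL|apply/asboolP].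
apply: contrapT => Ninf.
have [] := submod_max_cond
  (F := fun N => ~ exists L, forall p, assq N p -> List.In p L).
  by exists N.
move=> {Ninf}N Ninf Nmax; apply: (Ninf).
have [[u uN]|NT] := pselect (exists u, u \notin N); last first.
  exists [::] => p [[p1 _] [u pu]]; case/negP: p1; apply/pu; rewrite scale1r.
  by apply: contrapT => /negP uN; apply: NT; exists u.
have {u uN} [p [pp [v pv]] _] := assq_exists uN.
have vN : v \notin N.
  by case: (pp) => p1 _; apply: contra p1 => vN; apply/pv; rewrite scale1r.
have N1sub : subspace_prop (fun w => exists r, w - r *: v \in N).
  split=> [|a w1 w2 [r1 h1] [r2 h2]]; first by exists 0; rewrite scale0r subr0 rpred0.
  exists (a * r1 + r2).
  by rewrite scalerDl -scalerA opprD addrACA -scalerBr rpredD // rpredZ.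
pose N1 := submod_of N1sub.
have [L N1L] : exists L, forall p, assq N1 p -> List.In p L.
  apply: contrapT => h; case/negP: vN; rewrite -(Nmax N1 h).
    by apply/submod_ofP; exists 1; rewrite scale1r subrr rpred0.
  by move=> w wN; apply/submod_ofP; exists 0; rewrite scale0r subr0.
exists (p :: L) => q [qp [w qw]].
have [[s [/submod_ofP[t st] sw]]|nos] :=
    pselect (exists s, s *: w \in N1 /\ s *: w \notin N).
  (* Modulo [N], the non-zero element [s w] equals [t v]; its annihilator is both [q] and [p]. *)
  left; have sq : s \notin q by apply: contra sw => /qw.
  have tp : t \notin p.
    by apply: contra sw => /pv tv; rewrite -(subrK (t *: v) (s *: w)) rpredD.
  have rst r : (r * s) *: w - (r * t) *: v \in N.
    by rewrite -!scalerA -scalerBr rpredZ.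
  apply: submod_eq => r h; apply: contraT => nh.
    case/negP: (prime_idealM qp nh sq); apply/qw.
    rewrite -(subrK ((r * t) *: v) (_ *: w)) rpredD //; apply/pv.
    exact: mem_idealMr.
  case/negP: (prime_idealM pp nh tp); apply/pv.
  rewrite -[_ *: v](subKr ((r * s) *: w)); apply: submodB => //; apply/qw.
  exact: mem_idealMr.
right; apply: N1L; split=> //; exists w => r; split=> [/qw rw|rw].
  by apply/submod_ofP; exists 0; rewrite scale0r subr0.
by apply/qw; apply: contrapT => /negP h; apply: nos; exists r.
Qed.

(** * Prime avoidance *)

Lemma prime_avoid_mul (J : ideal R) p L : prime_ideal p -> ~ {subset J <= p} ->
  (forall q : ideal R, List.In q L -> ~ {subset q <= p}) ->
  exists y, [/\ y \in J, y \notin p & forall q : ideal R, List.In q L -> y \in q].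
Proof.
move=> pp Jp.
have wit (q : ideal R) : ~ {subset q <= p} -> exists2 y : R, y \in q & y \notin p.
  move=> qp; apply: contrapT => h; apply: qp => r rq.
  by apply: contraT => rp; case: h; exists r.
elim: L => [|q L IHL] Lp; first by have [y yJ yp] := wit _ Jp; exists y.
have [|y [yJ yp yL]] := IHL; first by move=> q' q'L; apply: Lp; right.
have [z zq zp] := wit _ (Lp q (or_introl erefl)).
exists (z * y); split; [exact: mem_idealMl|exact: prime_idealM|].
by move=> q' [<-|/yL]; [exact: mem_idealMr|exact: mem_idealMl].
Qed.

(** Induction on the number of primes: [x] avoids the primes of [L] not contained in [p]. If [x]
    lies in [p], add some [y] of [J] outside [p] but in all of those; primes inside [p] are avoided
    along with [p]. *)
Lemma prime_avoidance (J : ideal R) L :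
  (forall q : ideal R, List.In q L -> prime_ideal q /\ ~ {subset J <= q}) ->
  exists2 x, x \in J & forall q : ideal R, List.In q L -> x \notin q.
Proof.
have [n] := ubnP (size L); elim: n L => // n IHn [|p L] /=.
  by move=> _ _; exists 0; [exact: mem_ideal0|].
rewrite ltnS => sL Lp; have [pp Jp] := Lp p (or_introl erefl).
pose L' := List.filter (fun q : ideal R => `[< ~ {subset q <= p} >]) L.
have L'P q : List.In q L' <-> List.In q L /\ ~ {subset q <= p}.
  by rewrite List.filter_In; split=> -[? /asboolP].
have [||x xJ xL'] := IHn L'.
- apply: leq_ltn_trans sL; apply/ssrnat.leP; exact: List.filter_length_le.
- by move=> q /L'P[qL _]; apply: Lp; right.
have [xp|xp] := boolP (x \in p); last first.
  exists x => // q [<-//|qL].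
  have [qp|qp] := pselect {subset q <= p}; first by apply: contra xp; exact: qp.
  by apply: xL'; apply/L'P.
have [|y [yJ yp yL']] := @prime_avoid_mul J p L' pp Jp; first by move=> q /L'P[].
have xyp : x + y \notin p.
  by apply: contra yp => h; rewrite -(addKr x y) addrC mem_idealB.
exists (x + y); first exact: mem_idealD.
move=> q [<-//|qL].
have [qp|qp] := pselect {subset q <= p}; first by apply: contra xyp; exact: qp.
have qL' : List.In q L' by apply/L'P.
apply: contra (xL' q qL') => h; rewrite -(addrK y x); apply: mem_idealB => //; exact: yL'.
Qed.

(** Zero-divisors lie in associated primes, of which the submodules in [F] have finitely many
    altogether; prime avoidance applies. *)
Lemma exists_nzdq (J : ideal R) (F : seq (submodClosed M)) :
  (forall N p, List.In N F -> assq N p -> ~ {subset J <= p}) ->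
  exists2 x, x \in J & forall N, List.In N F -> nzdq N x.
Proof.
move=> FJ.
have [L LP] : exists L, forall p, List.In p L <-> exists2 N, List.In N F & assq N p.
  elim: F {FJ} => [|N F [L LP]]; first by exists [::] => p; split=> // -[].
  have [L1 L1P] := assq_finite N; exists (L1 ++ L)%SEQ => p.
  rewrite List.in_app_iff; split=> [[/L1P ?|/LP[N' ? ?]]|[N' [<- /L1P|? ?]]].
  - by exists N => //; left.
  - by exists N' => //; right.
  - by left.
  - by right; apply/LP; exists N'.
have [|x xJ xL] := @prime_avoidance J L.
  by move=> q /LP[N NF qN]; split; [case: qN|exact: FJ qN].
exists x => // N NF u xu; apply: contrapT => /negP uN.
have [p pN up] := assq_exists uN.
by case/negP: (xL p (proj2 (LP p) (ex_intro2 _ _ N NF pN))); exact: up.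
Qed.

(** * Exchange of regular elements *)

Lemma regular_swap N x y : nzdq N y -> nzdq (addx N y) x -> nzdq N x ->
  nzdq (addx N x) y.
Proof.
move=> yN xNy xN u /addxP[v yuv].
(* Modulo [N], [y u = x v]; regularity of [x] on [M/(N + yM)] gives [v = y w], and [y] cancels. *)
have /addxP[w vw] : v \in addx N y.
  apply: xNy; apply/addxP; exists u.
  by rewrite -opprB -scaleN1r rpredZ.
apply/addxP; exists w; apply: yN.
have -> : y *: (u - x *: w) = (y *: u - x *: v) + x *: (v - y *: w).
  by rewrite !scalerBr !scalerA (mulrC y) addrA subrK.
by rewrite rpredD // rpredZ.
Qed.

(** If [m] kills [u] modulo [N + xM], then [y u = x v] and [z u = x w] modulo [N]. Cancelling [x]
    puts [z v] into [N + yM], hence [v] too; cancelling [y] then puts [u] into [N + xM]. *)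
Lemma local_colon_nzdq N x y : nzdq N x -> nzdq N y -> y \in m ->
  (exists2 z, z \in m & nzdq (addx N y) z) ->
  forall p, assq (addx N x) p -> ~ {subset m <= p}.
Proof.
move=> xN yN ym [z zm zNy] p [[p1 _] [u pu]] mp.
have uNx : u \notin addx N x.
  by apply: contra p1 => h; apply/pu; rewrite scale1r.
have /pu/addxP[v yuv] := mp y ym.
have [|//] := boolP (v \in addx N y).
  move=> /addxP[w vw]; case/negP: uNx; apply/addxP; exists w; apply: yN.
  have -> : y *: (u - x *: w) = (y *: u - x *: v) + x *: (v - y *: w).
    by rewrite !scalerBr !scalerA (mulrC y) addrA subrK.
  by rewrite rpredD // rpredZ.
case/negP; apply: zNy; have /pu/addxP[w zuw] := mp z zm.
apply/addxP; exists w; apply: xN.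
have -> : x *: (z *: v - y *: w) = y *: (z *: u - x *: w) - z *: (y *: u - x *: v).
  rewrite !scalerBr !scalerA (mulrC z y) opprB [RHS]addrC addrA subrK.
  by rewrite (mulrC x z) (mulrC x y).
by apply: submodB; exact: rpredZ.
Qed.

(** Depth of [M/N] at least [n]; the base case states that the last quotient is non-zero. *)
Fixpoint has_regular n N : Prop :=
  if n is n'.+1 then exists x, [/\ x \in m, nzdq N x & has_regular n' (addx N x)]
  else exists u, u \notin N.

Lemma nakayama N x : x \in m -> (exists u, u \notin N) -> exists u, u \notin addx N x.
Proof.
move=> xm [u uN]; apply: contrapT => h.
have [||t /local_unit[s st] tu] := @local_nakayama m local_prime N (fun=> True) _ u.
- move=> {uN}u _; have /addxP[v uv] : u \in addx N x.
    by apply: contrapT => /negP ux; apply: h; exists u.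
  by exists 1, x, v; split; rewrite ?scale1r //; case: local_prime.
- by [].
by case/negP: uN; rewrite -[u]scale1r -st -scalerA rpredZ.
Qed.

Lemma has_regular_proper n N : has_regular n N -> exists u, u \notin N.
Proof.
elim: n N => //= n IHn N [x [_ _ /IHn[u uN]]].
by exists u; apply: contra uN; exact: sub_addx.
Qed.

(* Choosing [z] regular on [M/N], [M/(N + xM)] and [M/(N + yM)] lets the
   induction replace first [y] and then [x] by [z]. *)
Lemma has_regular_addx n N x : x \in m -> nzdq N x -> has_regular n.+1 N ->
  has_regular n (addx N x).
Proof.
elim: n N x => [|n IHn] N x xm xN.
  by move=> /has_regular_proper; exact: nakayama.
move=> [y [ym yN Ny]].
have Nyz : exists2 z, z \in m & nzdq (addx N y) z by case: Ny => z [? ? _]; exists z.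
have [|z zm zreg] := @exists_nzdq m [:: N; addx N x; addx N y].
  move=> _ p [<-|[<-|[<-|[]]]].
  - by move=> pN /(_ y ym); apply/negP; exact: nzdq_notin_assq pN.
  - exact: local_colon_nzdq xN yN ym Nyz p.
  - case: Nyz => z zm zN pN /(_ z zm); apply/negP; exact: nzdq_notin_assq pN.
have zN : nzdq N z by apply: zreg; left.
have zNx : nzdq (addx N x) z by apply: zreg; right; left.
have zNy : nzdq (addx N y) z by apply: zreg; do 2!right; left.
have Nz : has_regular n.+1 (addx N z).
  exists y; split=> //; first exact: regular_swap.
  by rewrite addxAC; exact: IHn.
exists z; split=> //; rewrite addxAC; apply: IHn => //; exact: regular_swap.
Qed.

(** * Chains of prime ideals *)

Fixpoint chain_from n p : Prop :=
  if n is n'.+1 then exists q : ideal R,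
    [/\ prime_ideal q, {subset p <= q}, ~ {subset q <= p} & chain_from n' q]
  else True.

Definition has_chain n (a : ideal R) : Prop :=
  exists p, [/\ prime_ideal p, {subset a <= p} & chain_from n p].

Lemma chain_from_leq n k p : (k <= n)%N -> chain_from n p -> chain_from k p.
Proof.
elim: n k p => [|n IHn] [|k] p //= kn [q [qp pq nqp qn]].
by exists q; split=> //; exact: IHn.
Qed.

Lemma has_chain_sub n (a b : ideal R) : {subset a <= b} -> has_chain n b -> has_chain n a.
Proof. by move=> ab [p [pp bp pn]]; exists p; split=> // r /ab/bp. Qed.

Lemma has_chain_leq n k (a : ideal R) : (k <= n)%N -> has_chain n a -> has_chain k a.
Proof. by move=> kn [p [pp ap /(chain_from_leq kn)]]; exists p. Qed.

Lemma annq_sub_assq N p : assq N p -> {subset annq N <= p}.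
Proof. by move=> [_ [u pu]] r /ideal_ofP rN; apply/pu. Qed.

Lemma sub_annq N N' : {subset N <= N'} -> {subset annq N <= annq N'}.
Proof. by move=> NN' r /ideal_ofP rN; apply/ideal_ofP => u; exact/NN'/rN. Qed.

(** Some [u] killed by [p] modulo [N] stays outside [N + xM]. An associated prime of [N + xM]
    containing the annihilator of its class contains [p] and [x], while [x] is not in [p]. *)
Lemma has_regular_chain n N p : has_regular n N -> assq N p -> chain_from n p.
Proof.
elim: n N p => //= n IHn N p [x [xm xN xn]] pN.
have xp := nzdq_notin_assq xN pN; case: (pN) => pp [u0 pu0].
have [u [pu ux]] : exists u, (forall r, r \in p -> r *: u \in N) /\ u \notin addx N x.
  apply: contrapT => h.
  pose S u := forall r, r \in p -> r *: u \in N.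
  have [||t /local_unit[s st] tu] := @local_nakayama m local_prime N S _ u0.
  - move=> u Su; have /addxP[v uv] : u \in addx N x.
      by apply: contrapT => /negP ux; apply: h; exists u.
    (* If [u = x v] modulo [N], then [p] kills [v] as well because [x] is regular, so [S] is
       divisible by [x]. *)
    exists 1, x, v; split; rewrite ?scale1r //; first by case: local_prime.
    move=> r rp; apply: xN; rewrite scalerA mulrC -scalerA.
    rewrite -[x *: v](subKr u) scalerBr; apply: submodB; [exact: Su|exact: rpredZ].
  - by move=> r /pu0.
  have : 1 \in p by apply/pu0; rewrite -st -scalerA rpredZ.
  by apply/negP; case: pp.
have [q qN uq] := assq_exists ux; exists q; split.
- by case: qN.
- by move=> r /pu ru; apply: uq; exact: sub_addx.
- by move=> qp; case/negP: xp; apply/qp/uq; exact: mem_addx.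
- exact: IHn qN.
Qed.

(** An associated prime of [N] below the chain lengthens it, as [x] lies in the bottom prime of the
    chain but in no associated prime. *)
Lemma has_chain_addx n N x : nzdq N x -> has_chain n (annq (addx N x)) ->
  has_chain n.+1 (annq N).
Proof.
move=> xN [P [Pp NP Pn]].
have [|p pN pP] := assq_sub_prime (N := N) Pp.
  by move=> r /(sub_annq (@sub_addx N x)); exact: NP.
have pp : prime_ideal p by case: pN.
exists p; split=> //; first exact: annq_sub_assq.
exists P; split=> // Pp'; case/negP: (nzdq_notin_assq xN pN); apply/Pp'/NP.
by apply/ideal_ofP => u; exact: mem_addx.
Qed.

Lemma has_chain_proper n N : has_chain n (annq N) -> exists u, u \notin N.
Proof.
case=> P [[P1 _] NP _]; apply: contrapT => h; case/negP: P1; apply: NP.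
apply/ideal_ofP => u; apply: contrapT => /negP; rewrite scale1r => uN.
by apply: h; exists u.
Qed.

(** If some [r] outside [P] killed [M/(N + xM)], Nakayama's lemma would make the localisation of
    [M/N] at [P] vanish, although [u] survives there. *)
Lemma annq_addx_sub_prime N p P x : assq N p -> prime_ideal P ->
  {subset p <= P} -> x \in P -> {subset annq (addx N x) <= P}.
Proof.
move=> [_ [u pu]] Pp pP xP r /ideal_ofP rN; apply: contraT => rP.
have [||t tP tu] := @local_nakayama P Pp N (fun=> True) _ u => //.
  by move=> v _; have /addxP[w h] := rN v; exists r, x, w.
by case/negP: tP; apply/pP/pu.
Qed.

(** The inequality [dim M/N <= dim R/p] through chains; the converse one is automatic since [p]
    contains the annihilator of [M/N]. *)
Definition unmixedq N : Prop :=
  forall p n, assq N p -> has_chain n (annq N) -> has_chain n p.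

Fixpoint regularq N (xs : seq R) : Prop :=
  if xs is x :: xs' then nzdq N x /\ regularq (addx N x) xs'
  else exists u, u \notin N.

Definition addxs N (xs : seq R) : submodClosed M := foldl addx N xs.

Lemma sub_addxs N xs : {subset N <= addxs N xs}.
Proof.
by elim: xs N => [|x xs IHxs] N u uN //=; apply: IHxs; exact: sub_addx.
Qed.

Lemma prime_sub_local p : prime_ideal p -> {subset p <= m}.
Proof. by move=> [p1 _]; exact: proper_sub_local. Qed.

(** * Regular sequences from chains of primes *)

Lemma assq_maximal N p0 : assq N p0 ->
  exists2 p, assq N p & forall q, assq N q -> {subset p <= q} -> q = p.
Proof.
move=> p0N; have [] := noetherian_max_cond (F := assq N) R_noetherian.
  by exists p0.
by move=> p pN pmax; exists p.
Qed.

(** An associated prime containing [P] would contain [p], hence equal [p], against [P] not lying in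
    [p]; so prime avoidance applies to [P]. *)
Lemma exists_nzdq_prime N p P : assq N p ->
  (forall q, assq N q -> {subset p <= q} -> q = p) ->
  {subset p <= P} -> ~ {subset P <= p} -> exists2 x, x \in P & nzdq N x.
Proof.
move=> pN pmax pP Pp.
have [|x xP xN] := @exists_nzdq P [:: N].
  move=> _ q [<-|[]] qN Pq; apply: Pp; rewrite -(pmax q qN) // => r /pP; exact: Pq.
by exists x => //; apply: xN; left.
Qed.

(** A regular [x] in [P] is divided out; the chain from [P] survives in the support of
    [M/(N + xM)]. *)
Lemma has_chain_regular_step n N p P : assq N p ->
  (forall q, assq N q -> {subset p <= q} -> q = p) ->
  prime_ideal P -> {subset p <= P} -> ~ {subset P <= p} -> chain_from n P ->
  (forall x, x \in m -> nzdq N x -> has_chain n (annq (addx N x)) ->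
     has_regular n (addx N x)) ->
  has_regular n.+1 N.
Proof.
move=> pN pmax Pp pP nPp Pn IH; have [x xP xN] := exists_nzdq_prime pN pmax pP nPp.
have xm := prime_sub_local Pp xP; exists x; split=> //; apply: IH => //.
by exists P; split=> //; exact: annq_addx_sub_prime pN Pp pP xP.
Qed.

(* Unmixedness moves the chain into [V(p)] for a maximal associated prime [p];
   then the next prime of the chain contains a regular element. *)
Lemma unmixed_has_regular n N :
  (forall xs, regularq N xs -> unmixedq (addxs N xs)) ->
  has_chain n (annq N) -> has_regular n N.
Proof.
elim: n N => [|n IHn] N NU Nn; first exact: has_chain_proper Nn.
have [u uN] := has_chain_proper Nn.
have [p0 /assq_maximal[p pN pmax] _] := assq_exists uN.
have [P0 [P0p pP0 [P [Pp P0P PP0 Pn]]]] : has_chain n.+1 p.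
  by apply: (NU [::]) => //; exists u.
apply: (has_chain_regular_step pN pmax Pp _ _ Pn).
- by move=> r /pP0/P0P.
- by move=> h; apply: PP0 => r /h/pP0.
by move=> x xm xN xn; apply: IHn => // xs xsN; apply: (NU (x :: xs)).
Qed.

(* The first step uses that the associated primes are minimal instead of
   unmixedness of [M/N] itself. *)
Lemma unmixed_has_regular_minimal n N :
  (forall p q, assq N p -> assq N q -> {subset q <= p} -> q = p) ->
  (forall x xs, regularq N (x :: xs) -> unmixedq (addxs N (x :: xs))) ->
  has_chain n (annq N) -> has_regular n N.
Proof.
move=> Nmin NU; case: n => [|n]; first exact: has_chain_proper.
move=> [P0 [P0p NP0 [P [Pp P0P PP0 Pn]]]].
have [p pN pP0] := assq_sub_prime P0p NP0.
apply: (has_chain_regular_step pN _ Pp _ _ Pn).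
(* Associated primes are pairwise incomparable, so [p] is also maximal among them. *)
- by move=> q qN pq; rewrite (Nmin q p).
- by move=> r /pP0/P0P.
- by move=> h; apply: PP0 => r /h/pP0.
by move=> x xm xN xn; apply: unmixed_has_regular => // xs xsN; exact: NU.
Qed.

(** * Dividing out a regular sequence *)

Lemma has_regular_leq n k N : (k <= n)%N -> has_regular n N -> has_regular k N.
Proof.
elim: n k N => [|n IHn] [|k] N //; first by move=> _ /has_regular_proper.
by move=> kn [x [xm xN xn]]; exists x; split=> //; exact: IHn.
Qed.

Lemma regularq_proper N xs : regularq N xs -> exists u, u \notin addxs N xs.
Proof. by elim: xs N => [|x xs IHxs] N //= [_ /IHxs]. Qed.

(** An entry outside [m] would be a unit and make the final quotient zero. *)
Lemma regularq_local N xs : regularq N xs -> {subset xs <= m}.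
Proof.
elim: xs N => [|x xs IHxs] N //= [_ xsN] y.
rewrite inE => /predU1P[->|]; last exact: IHxs xsN y.
apply: contraT => /local_unit[s sx]; have [u] := regularq_proper xsN; case/negP.
apply: sub_addxs; rewrite -[u]scale1r -sx mulrC -scalerA; exact: mem_addx.
Qed.

Lemma has_chain_addxs n N xs : regularq N xs -> has_chain n (annq (addxs N xs)) ->
  has_chain (n + size xs) (annq N).
Proof.
elim: xs N => [|x xs IHxs] N /=; first by rewrite addn0.
by move=> [xN xsN] /(IHxs _ xsN)/(has_chain_addx xN); rewrite addnS.
Qed.

Lemma has_regular_addxs n N xs : regularq N xs -> has_regular (n + size xs) N ->
  has_regular n (addxs N xs).
Proof.
elim: xs N => [|x xs IHxs] N; first by rewrite addn0.
move=> xxsN; have xm := regularq_local xxsN (mem_head _ _).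
by case: xxsN => xN xsN; rewrite addnS => h; apply: IHxs => //; exact: has_regular_addx.
Qed.

(** A chain for the quotient by [xs] gains [size xs] steps over [N]; the assumption gives a regular
    sequence at least that long, and at least [n] elements remain after dividing out [xs]. *)
Lemma regular_chain_from n N xs p : regularq N xs ->
  (forall k, has_chain k (annq N) -> exists2 l, has_regular l N & (k <= l)%N) ->
  assq (addxs N xs) p -> has_chain n (annq (addxs N xs)) -> chain_from n p.
Proof.
move=> xsN CM pN /(has_chain_addxs xsN)/CM[l Nl nl]; apply: has_regular_chain pN.
by apply: has_regular_addxs => //; exact: has_regular_leq nl Nl.
Qed.

Lemma has_regularP n N : has_regular n N <->
  exists xs : seq R, [/\ regularq N xs, {subset xs <= m} & size xs = n].
Proof.
elim: n N => [|n IHn] N /=.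
  by split=> [uN|[[|x xs] [h _ //]]]; exists [::].
split=> [[x [xm xN /IHn[xs [xsN xsm <-]]]]|[[|x xs] [//= [xN xsN] xsm [sn]]]].
  by exists (x :: xs); split=> // y; rewrite inE => /predU1P[->|/xsm].
exists x; split=> //; first by apply: xsm; exact: mem_head.
by apply/IHn; exists xs; split=> // y yxs; apply: xsm; rewrite inE yxs orbT.
Qed.

(* [M/K] embeds in a finite power of [M/N] through the generators of [b]. *)
Lemma assq_colon N (K : submodClosed M) (b : ideal R) p :
  K =i colon N b -> assq K p -> assq N p.
Proof.
move=> KE [pp [u pu]]; split=> //; have [s bs] := R_noetherian b.
have puN r x : r \in p -> x \in b -> r *: (x *: u) \in N.
  move=> /pu; rewrite KE => /asboolP h xb; rewrite scalerA mulrC -scalerA; exact: h.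
have [[x xb xu]|nox] :=
    pselect (exists2 x : R, x \in b & forall r, r *: (x *: u) \in N -> r \in p).
  by exists (x *: u) => r; split; [move=> rp; exact: puN|exact: xu].
(* Otherwise one [t] outside [p] sends [b u] into [N], so [t u] is in [K] and [t] in [p]. *)
have [|t tp tb] := @clear_denominators R^o (colon1 N u) p s pp.
  move=> x xs; apply: contrapT => h; apply: nox; exists x.
    by rewrite bs; exact: mem_submod_gen.
  move=> r rxu; apply: contrapT => /negP rp; apply: h; exists r => //.
  by apply/submod_ofP; move: rxu; rewrite scalerA.
case/negP: tp; apply/pu; rewrite KE; apply/asboolP => x; rewrite bs => /tb/submod_ofP.
by rewrite scalerA mulrC.
Qed.

End Core.

(** * Dimension and depth *)

Section NatSupremum.
Local Open Scope classical_set_scope.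
Implicit Types A B : set nat.

Definition natsup A : \bar int := supremum -oo%E [set (n%:Z)%:E%E | n in A].

(** [supremum] is chosen among the least upper bounds, so one must exist: the maximum of a bounded
    set, [+oo] for an unbounded one. *)
Lemma natsupP A : A !=set0 -> supremums [set (n%:Z)%:E%E | n in A] (natsup A).
Proof.
move=> [n0 An0]; rewrite /natsup /supremum ifF; last first.
  by apply/negP => /eqP e; have : set0 (n0%:Z)%:E%E by rewrite -e; exists n0.
suff [s sP] : supremums [set (n%:Z)%:E%E | n in A] !=set0.
  by case: xgetP => // /(_ s).
have [[k Ak]|Aunb] := pselect (exists k, forall n, A n -> (n <= k)%N).
  have [|n nk|i Ai imax] := @ex_maxnP (fun n => `[< A n >]) k.
  - by exists n0; apply/asboolP.
  - by apply: Ak; apply/asboolP.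
  exists (i%:Z)%:E%E; split.
    by move=> _ [n An <-]; rewrite lee_fin lez_nat imax //; apply/asboolP.
  by move=> b; apply; exists i => //; apply/asboolP.
exists +oo%E; split=> [_ [n _ <-]|b bub]; first exact: leey.
case: b bub => [r|//|] bub //; last by have := bub _ (ex_intro2 _ _ n0 An0 erefl).
case: Aunb; exists `|r|%N => n An.
have := bub _ (ex_intro2 _ _ n An erefl); rewrite lee_fin => nr.
by rewrite -lez_nat (le_trans nr) // abszE ler_norm.
Qed.

(** Turns equal dimensions or depths, infinite ones included, into a comparison of lengths: were all
    members of [B] below [n], the supremum would be at most [n - 1]. *)
Lemma natsup_eq A B n : natsup A = natsup B -> A n -> exists2 k, B k & (n <= k)%N.
Proof.
move=> AB An; apply: contrapT => nB.
have [Aub _] := natsupP (ex_intro _ n An).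
have {Aub} nA : (n%:Z%:E <= natsup B)%E by rewrite -AB; apply: Aub; exists n.
have [[k0 Bk0]|B0] := pselect (B !=set0); last first.
  move: nA; rewrite /natsup (_ : B = set0) ?image_set0 ?supremum0 //.
  by apply/seteqP; split=> // k Bk; apply: B0; exists k.
have Bn k : B k -> (k < n)%N.
  by move=> Bk; rewrite ltnNge; apply/negP => nk; apply: nB; exists k.
have n_gt0 : (0 < n)%N := leq_ltn_trans (leq0n _) (Bn _ Bk0).
have [_ Bleast] := natsupP (ex_intro _ k0 Bk0).
have : (natsup B <= (n.-1%:Z)%:E)%E.
  by apply: Bleast => _ [k Bk <-]; rewrite lee_fin lez_nat -ltnS prednK // Bn.
by move=> /(le_trans nA); rewrite lee_fin lez_nat -ltnS prednK ?ltnn.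
Qed.

End NatSupremum.

(** * Quotient modules expressed through submodules *)

Section Quotients.
Variables (R : comNzRingType) (M : lmodType R).
Implicit Types (N : submodClosed M) (p : ideal R).

Lemma quotmod_pi_eq0 N u : quotmod_pi N u = 0 <-> u \in N.
Proof.
rewrite -[0](linear0 (quotmod_pi N)) -[X in _ <-> X \in _]subr0.
exact: quotmod_eqP.
Qed.

Lemma quotmod_scale_eq0 N r u : r *: quotmod_pi N u = 0 <-> r *: u \in N.
Proof. by rewrite -linearZ; exact: quotmod_pi_eq0. Qed.

Lemma nonzerodivisor_quotmod N x : nonzerodivisor (quotmod N) x <-> nzdq N x.
Proof.
split=> xN u.
  by move=> /quotmod_scale_eq0/xN/quotmod_pi_eq0.
by rewrite -(quotmod_piK u) => /quotmod_scale_eq0/xN/quotmod_pi_eq0.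
Qed.

Lemma Ass_quotmod N p : Ass (quotmod N) p <-> assq N p.
Proof.
split=> -[pp [u pu]]; split=> //.
  by exists (repr u) => r; rewrite -quotmod_scale_eq0 quotmod_piK.
by exists (quotmod_pi N u) => r; rewrite quotmod_scale_eq0.
Qed.

Lemma annihilates_quotmod N r : annihilates (quotmod N) r <-> r \in annq N.
Proof.
split=> [rN|/ideal_ofP rN u]; last first.
  by rewrite -(quotmod_piK u); apply/quotmod_scale_eq0/rN.
by apply/ideal_ofP => u; apply/quotmod_scale_eq0/rN.
Qed.

End Quotients.

Lemma annihilates_quotmod_ideal (R : comNzRingType) (p : ideal R) (r : R) :
  annihilates (quotmod p) r <-> r \in p.
Proof.
split=> [rp|rp u].
  have /quotmod_scale_eq0 := rp (quotmod_pi p (1 : R)).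
  by rewrite -[r *: _]/(r * 1) mulr1.
rewrite -(quotmod_piK u); apply/quotmod_scale_eq0.
exact: (mem_idealMr _ rp).
Qed.

(** * Krull dimension through chains *)

Section Dimension.
Variables (R : comNzRingType).
Implicit Types (p : ideal R) (a : ideal R).

Lemma chain_fromP n p : chain_from n p -> exists f : nat -> ideal R, f 0%N = p /\
  forall i, (i < n)%N -> [/\ prime_ideal (f i.+1), {subset f i <= f i.+1}
    & ~ {subset f i.+1 <= f i}].
Proof.
elim: n p => [|n IHn] p /=; first by exists (fun=> p).
move=> [q [qp pq nqp /IHn[f [f0 fP]]]].
exists (fun i => if i is i'.+1 then f i' else p); split=> // -[_|i]; last exact: fP.
by rewrite f0.
Qed.

Lemma prime_chain_has_chain (L : lmodType R) n a :
  (forall r, annihilates L r <-> r \in a) ->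
  (exists p : 'I_n.+1 -> ideal R, prime_chain L p) <-> has_chain n a.
Proof.
move=> La; split=> [[p [pp Lp pmono]]|[q [qp aq /chain_fromP[f [f0 fP]]]]].
  have chain k j : (k + j <= n)%N -> chain_from k (p (inord j)).
    elim: k j => //= k IHk j kj; exists (p (inord j.+1)).
    have [|sub nsub] := pmono (inord j) (inord j.+1).
      by rewrite !inordK ?ltnS //; lia.
    by split=> //; apply: IHk; lia.
  exists (p (inord 0)); split=> //; last by apply: chain; rewrite addn0.
  by move=> r /La; exact: Lp.
have fp i : (i <= n)%N -> prime_ideal (f i).
  by case: i => [|i /fP[]//]; rewrite f0.
have fmono i j : (i <= j <= n)%N -> {subset f i <= f j}.
  elim: j => [|j IHj]; first by rewrite leqn0 => /andP[/eqP-> _] r.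
  rewrite leq_eqVlt => /andP[/predU1P[->|ij] jn] r ri //.
  have [_ sub _] := fP j jn; apply/sub/IHj => //; apply/andP; split=> //; exact: ltnW.
exists (fun i : 'I_n.+1 => f i); split=> [i|i r /La ra|i j ij].
- by apply: fp; rewrite -ltnS.
- have i0 : (0 <= i <= n)%N by rewrite leq0n -ltnS ltn_ord.
  by apply: (fmono _ _ i0 r); rewrite f0; apply: aq.
have jn : (j <= n)%N by rewrite -ltnS.
split; first by apply: fmono; rewrite ltnW.
have [_ _ nsub] := fP i (leq_trans ij jn); move=> h; apply: nsub => r ri.
by apply/h/(fmono i.+1 j) => //; rewrite ij.
Qed.

Lemma krull_dimE (L : lmodType R) a : (forall r, annihilates L r <-> r \in a) ->
  krull_dim L = natsup (fun n => has_chain n a).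
Proof.
move=> La; rewrite /krull_dim; congr (supremum _ (image _ _)).
by apply/funext => n; apply/propext; exact: prime_chain_has_chain.
Qed.

End Dimension.

(** * Linkage *)

Section RegularSequences.
Variables (R : comNzRingType) (M : lmodType R).
Implicit Types (N : submodClosed M) (a : ideal R) (xs : seq R).

Definition sub0 : submodClosed M := submod_gen ([::] : seq M).

Lemma mem_sub0 u : u \in sub0 <-> u = 0.
Proof. by rewrite mem_submod_gen_nil; split=> /eqP. Qed.

Definition ideal_mulS a : submodClosed M := ideal_mul M a.

Lemma mem_ideal_mul a (r : R) (u : M) : r \in a -> r *: u \in ideal_mulS a.
Proof.
move=> ra; apply/asboolP; exists 1%N, (fun=> r), (fun=> u).
by rewrite big_ord1.
Qed.

Lemma ideal_mul_least a N : (forall (r : R) u, r \in a -> r *: u \in N) ->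
  {subset ideal_mulS a <= N}.
Proof.
move=> aN _ /asboolP[n [r [u [ra ->]]]].
by apply: rpred_sum => i _; exact: aN.
Qed.

Lemma addxs_least N N' xs : {subset N <= N'} ->
  (forall x w, x \in xs -> x *: w \in N') -> {subset addxs N xs <= N'}.
Proof.
elim: xs N => [|x xs IHxs] N //= NN' xsN'; apply: IHxs.
  by apply: addx_least => // w; apply: xsN'; exact: mem_head.
by move=> y w yxs; apply: xsN'; rewrite inE yxs orbT.
Qed.

Lemma mem_addxs N xs x w : x \in xs -> x *: w \in addxs N xs.
Proof.
elim: xs N => //= y xs IHxs N; rewrite inE => /predU1P[->|]; last exact: IHxs.
by apply: sub_addxs; exact: mem_addx.
Qed.

Lemma ideal_mul_gen xs : ideal_mulS (submod_gen (xs : seq R^o)) = addxs sub0 xs.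
Proof.
apply: submod_eq.
  apply: ideal_mul_least => r u rxs.
  (* The elements sending [M] into [addxs sub0 xs] form an ideal, so testing the generators
     suffices. *)
  have xsN : {subset (xs : seq R^o) <= annq (addxs sub0 xs)}.
    by move=> x xxs; apply/ideal_ofP => w; exact: mem_addxs.
  by have /ideal_ofP := submod_gen_sub xsN rxs; apply.
apply: addxs_least => [u /mem_sub0->|x w xxs]; first exact: rpred0.
by apply: mem_ideal_mul; exact: mem_submod_gen.
Qed.

Lemma regularqP N xs : regularq N xs <->
  (forall i, (i < size xs)%N -> nzdq (addxs N (take i xs)) xs`_i) /\
  ~ (forall u, u \in addxs N xs).
Proof.
elim: xs N => [|x xs IHxs] N /=.
  split=> [[u uN]|[_ NT]]; first by split=> // /(_ u); apply/negP.
  apply: contrapT => h; apply: NT => u.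
  by apply: contrapT => /negP uN; apply: h; exists u.
rewrite IHxs; split=> [[xN [xsN NT]]|[xsN NT]].
  by split=> // -[|i] //=; exact: xsN.
by split; [exact: (xsN 0%N)|split=> // i; exact: (xsN i.+1)].
Qed.

Lemma regular_seqP xs : regular_seq M xs <-> regularq sub0 xs.
Proof.
rewrite regularqP /regular_seq -ideal_mul_gen; split=> -[xsM MT]; split=> // i ixs.
  by rewrite -ideal_mul_gen; apply/nonzerodivisor_quotmod; exact: xsM.
by apply/nonzerodivisor_quotmod; have := xsM i ixs; rewrite -ideal_mul_gen.
Qed.

Lemma regularq_rcons N xs y : regularq N (rcons xs y) <->
  nzdq (addxs N xs) y /\ regularq N xs /\ exists u, u \notin addx (addxs N xs) y.
Proof.
elim: xs N => [|x xs IHxs] N /=; last by rewrite IHxs; tauto.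
split=> [[yN [u uN]]|[? [? ?]] //]; split=> //; split; exists u => //.
by apply: contra uN; exact: sub_addx.
Qed.

Lemma addxs_rcons N xs y : addxs N (rcons xs y) = addx (addxs N xs) y.
Proof. exact: foldl_rcons. Qed.

Lemma annihilates_sub0 r : annihilates M r <-> r \in annq sub0.
Proof.
split=> [rM|/ideal_ofP rM u]; last exact/mem_sub0/rM.
by apply/ideal_ofP => u; apply/mem_sub0/rM.
Qed.

Lemma Ass_sub0 p : Ass M p <-> assq sub0 p.
Proof.
by split=> -[pp [u pu]]; split=> //; exists u => r; rewrite pu mem_sub0.
Qed.

Lemma depthE (m : ideal R) : depth m M = natsup (fun n => has_regular m n sub0).
Proof.
rewrite /depth /natsup; congr (supremum _ _); apply/funext => e; apply/propext; split.
  move=> [xs [/regular_seqP xsM xsm] <-]; exists (size xs) => //.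
  by apply/has_regularP; exists xs.
move=> [n /has_regularP[xs [xsM xsm <-]] <-]; exists xs => //; split=> //.
exact/regular_seqP.
Qed.

Lemma krull_dim_quotmod N :
  krull_dim (quotmod N) = natsup (fun n => has_chain n (annq N)).
Proof. by apply: krull_dimE => r; exact: annihilates_quotmod. Qed.

Lemma krull_dim_quotmod_ideal (p : ideal R) :
  krull_dim (quotmod p) = natsup (fun n => has_chain n p).
Proof. by apply: krull_dimE => r; exact: annihilates_quotmod_ideal. Qed.

Lemma unmixed_quotmod N : unmixed (quotmod N) <-> unmixedq N.
Proof.
split=> [NU p n /Ass_quotmod/NU|NU p /Ass_quotmod pN];
    rewrite krull_dim_quotmod krull_dim_quotmod_ideal.
  by move=> e Nn; have [k pk nk] := natsup_eq (esym e) Nn; exact: has_chain_leq nk pk.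
congr natsup; apply/funext => n; apply/propext; split; last exact: NU.
by apply: has_chain_sub; exact: annq_sub_assq.
Qed.

(** The ideal is linked to itself through the sequence with [y] squared: as [y] is regular on [M/N],
    it sends exactly the elements of [N + yM] into [N + y^2 M]. *)
Lemma linked_regular_seq xs y : regularq sub0 (rcons xs y) ->
  linked M (submod_gen (rcons xs y : seq R^o)).
Proof.
move=> reg; have /regularq_rcons[yN [xsM [u0 u0N]]] := reg.
set N := addxs sub0 xs in yN u0N.
pose a : ideal R := submod_gen (rcons xs y : seq R^o).
pose I : ideal R := submod_gen (rcons xs (y * y) : seq R^o).
have aE : ideal_mulS a = addx N y by rewrite ideal_mul_gen addxs_rcons.
have IE : ideal_mulS I = addx N (y * y) by rewrite ideal_mul_gen addxs_rcons.
have ya : y \in a by apply: mem_submod_gen; rewrite mem_rcons mem_head.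
have aT : ~ (forall u, u \in ideal_mulS a) by rewrite aE => /(_ u0); exact/negP.
have a0 : nonzero_ideal a.
  exists y => //; apply/eqP => y0; case/negP: u0N; apply: sub_addx; apply: yN.
  by rewrite y0 scale0r rpred0.
have a1 : is_proper a.
  by apply/negP => a1; apply: aT => u; rewrite -[u]scale1r; exact: mem_ideal_mul.
have Ia : {subset I <= a}.
  apply: submod_gen_sub => x; rewrite mem_rcons inE => /predU1P[->|xxs].
    exact: mem_idealMl.
  by apply: mem_submod_gen; rewrite mem_rcons inE xxs orbT.
have Ireg : regular_seq M (rcons xs (y * y)).
  apply/regular_seqP/regularq_rcons; split.
    by move=> u; rewrite -scalerA => /yN/yN.
  split=> //; exists u0; apply: contra u0N; apply: addx_least => [|w].
    exact: sub_addx.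
  by rewrite -scalerA; exact: mem_addx.
have colonE : ideal_mul M a =i colon (ideal_mul M I) a.
  move=> u; rewrite -[_ \in ideal_mul M a]/(u \in ideal_mulS a) aE.
  apply/idP/asboolP => [uN r ra|h]; last first.
    have : y *: u \in ideal_mulS I by exact: h.
    rewrite IE => /addxP[w h']; apply/addxP; exists w; apply: yN.
    by rewrite scalerBr scalerA.
  rewrite -[_ \in _]/(_ \in ideal_mulS I) IE.
  have [w uw] := (addxP _ _ _).1 uN.
  (* Here [u = y w] modulo [N] and [r w] lies in [aM = N + yM], so [r u] lies in [N + y^2 M]. *)
  have : r *: w \in addx N y by rewrite -aE; exact: mem_ideal_mul.
  move=> /addxP[w' rw]; apply/addxP; exists w'.
  have -> : r *: u - (y * y) *: w' = r *: (u - y *: w) + y *: (r *: w - y *: w').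
    by rewrite !scalerBr !scalerA (mulrC y r) addrA subrK.
  by rewrite rpredD // rpredZ.
exists I, a; split=> //; split=> //; by exists (rcons xs (y * y)).
Qed.

End RegularSequences.

(** The bound [depth <= dim] follows from [has_regular_chain] at any associated prime, which exists
    as [M] is non-zero; only the reverse bound remains. *)
Lemma cohen_macaulayP (R : comNzRingType) (m : ideal R) (M : lmodType R) :
  noetherian R -> local_ring m -> fin_gen (predT : {pred M}) -> ~ zero_module M ->
  cohen_macaulay m M <-> forall n, has_chain n (annq (sub0 M)) ->
    exists2 k, has_regular m k (sub0 M) & (n <= k)%N.
Proof.
move=> noeth loc Mfg M0; rewrite /cohen_macaulay depthE.
rewrite (krull_dimE (@annihilates_sub0 R M)); split=> [[//|e] n Mn|h]; last right.
  exact: natsup_eq (esym e) Mn.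
have [u uN] : exists u : M, u \notin sub0 M.
  apply: contrapT => h'; apply: M0 => u; apply/mem_sub0.
  by apply: contrapT => /negP uN; apply: h'; exists u.
have [p pN _] := assq_exists noeth loc uN.
congr natsup; apply/funext => n; apply/propext; split=> [Mn|/h[k Mk nk]].
  exists p; split; [by case: pN|exact: annq_sub_assq|exact: has_regular_chain Mn pN].
exact: has_regular_leq nk Mk.
Qed.

Lemma linked_unmixed_iff (R : comNzRingType) (m : ideal R) (M : lmodType R) :
  noetherian R -> local_ring m -> fin_gen (predT : {pred M}) ->
  (forall p : ideal R, Ass M p -> minimal_Ass M p) ->
  cohen_macaulay m M <->
  forall a : ideal R, linked M a -> unmixed (quotmod (ideal_mul M a)).
Proof.
move=> noeth loc Mfg Mmin.
have [M0|M0] := pselect (zero_module M).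
  (* No ideal is linked with respect to the zero module, since [aM] must differ from [M]. *)
  split=> [_ a [I [b [_ _ [aT _] _ _]]]|_]; last by left.
  by case: aT => u; rewrite (M0 u) rpred0.
rewrite (cohen_macaulayP noeth loc Mfg M0); split=> [CM a|unm n Mn].
  move=> [I [b [_ _ _ [[xs /regular_seqP xsM IE] _ _] [_ aE]]]].
  have {}IE : I = submod_gen (xs : seq R^o) by apply: submodP.
  apply/unmixed_quotmod => p n pa an.
  have aI : ideal_mul M a =i colon (addxs (sub0 M) xs) b.
    by move=> u; rewrite aE IE -ideal_mul_gen.
  exists p; split=> //; first by case: pa.
  apply: (regular_chain_from noeth loc Mfg xsM CM (assq_colon noeth aI pa)).
  (* As [IM] is contained in [aM], chains for [M/aM] are chains for [M/IM]. *)
  apply: has_chain_sub an; apply: sub_annq => u uI; rewrite aE.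
  apply/asboolP => r _; rewrite IE; have := uI; rewrite -ideal_mul_gen; exact: rpredZ.
exists n => //; apply: unmixed_has_regular_minimal Mn => //.
  move=> p q /Ass_sub0/Mmin[_ pmin] /Ass_sub0 qM qp; apply: submod_eq => //.
  exact: pmin.
(* [lastI] exposes the last entry, which the self-linkage squares. *)
move=> x xs; rewrite lastI => xsM; apply/unmixed_quotmod.
by rewrite -ideal_mul_gen; apply: unm; exact: linked_regular_seq.
Qed.

Lemma ideal_mul_regular (R : comNzRingType) (a : ideal R) : ideal_mulS R^o a = a.
Proof.
apply: submod_eq => [|r ra].
  by apply: ideal_mul_least => r u ra; exact: mem_idealMr.
by rewrite -[r]mulr1; exact: (@mem_ideal_mul R R^o).
Qed.

Theorem theorem3p5 (R : comNzRingType) (m : ideal R)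
  (R_noetherian : noetherian R) (R_local : local_ring m) :
  (forall M : lmodType R,
     fin_gen (predT : {pred M}) ->
     (forall p : ideal R, Ass M p -> minimal_Ass M p) ->
     (cohen_macaulay m M <->
      forall a : ideal R, linked M a -> unmixed (quotmod (ideal_mul M a))))
  /\
  ((forall p : ideal R, Ass R^o p -> minimal_prime p) ->
   (cohen_macaulay m R^o <->
    forall a : ideal R, linked R^o a -> unmixed_ideal a)).
Proof.
split=> [M|Rmin]; first exact: linked_unmixed_iff.
have Rfg : fin_gen (predT : {pred R^o}).
  exists [:: 1] => r; symmetry; apply/mem_submod_gen_cons; exists r.
  by rewrite -[r *: 1]/(r * 1) mulr1 subrr rpred0.
rewrite (linked_unmixed_iff R_noetherian R_local Rfg); last first.
  (* A prime minimal among all primes is minimal among the associated ones. *)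
  by move=> p pR; split=> // q [qp _]; case: (Rmin p pR) => _; exact.
have unmixedE (a : ideal R) : unmixed (quotmod (ideal_mul R^o a)) = unmixed_ideal a.
  exact: (congr1 (fun N => unmixed (quotmod N)) (ideal_mul_regular a)).
by split=> h a /h; rewrite unmixedE.
Qed.
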